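(* Let $G=(V,E)$ be a graph with $|V|=n$, $|E|=m$, and $c:V\to\{0,1\}$, and suppose the Tseitin formula $\mathrm{TS}_{G,c}$ is satisfiable. Then $$\widehat{C}(\mathrm{TS}_{G,c})\ge\max_{1\le\ell\le m}2^{\,n-\kappa_G(\ell)-\kappa_G(m-\ell)+\kappa(G)}.$$
   Context: $\mathrm{TS}_{G,c}:\{0,1\}^E\to\{0,1\}$ maps $x=(x_e)_{e\in E}$ to $1$ iff for every $v\in V$, $\sum_{e\ni v}x_e\equiv c(v)\pmod2$; it is satisfiable if it is not identically 0. $\kappa(H)$ is the number of connected components of a graph $H$, and $\kappa_G(\ell)=\max\{\kappa(H): H \text{ a subgraph of } G \text{ with } |E(H)|=\ell\}$. Identify $E$ with $[m]$. For $f:\{0,1\}^m\to\{0,1\}$ and $A\subseteq[m]$, $f$ is an $A$-rectangle if $f(x)=g(x|_A)\wedge h(x|_{[m]\setminus A})$ for some Boolean functions $g,h$, and a $k$-rectangle if it is an $A$-rectangle for some $|A|=k$. $C(f,k)$ is the least $r$ such that $f$ is the OR of $r$ $k$-rectangles, and $\widehat{C}(f)=\max_{k\in[m]}C(f,k)$. *)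

(* Defs.v *)
From HB Require Import structures.
From mathcomp Require Import all_boot all_order all_algebra.
Set Implicit Arguments.
Unset Strict Implicit.
Unset Printing Implicit Defensive.

(* Finite simple graphs whose vertices are taken from a finite type [T]. *)
Definition graph_axiom (T : finType) (G : {set T} * {set {set T}}) : bool :=
  [forall e in G.2, (e \subset G.1) && (#|e| == 2)].

Record graph (T : finType) := Graph {
  graph_val : {set T} * {set {set T}};
  graphP : graph_axiom graph_val }.

HB.instance Definition _ (T : finType) := [isSub for @graph_val T].
HB.instance Definition _ (T : finType) := [Finite of graph T by <:].

Definition vset (T : finType) (G : graph T) : {set T} := (graph_val G).1.
Definition eset (T : finType) (G : graph T) : {set {set T}} := (graph_val G).2.

Definition subgraph (T : finType) (H G : graph T) : bool :=
  (vset H \subset vset G) && (eset H \subset eset G).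

Definition adj (T : finType) (G : graph T) : rel T :=
  [rel u v | [set u; v] \in eset G].

(* [n_comp] counts classes correctly only for a symmetric connectivity relation
   and a closed vertex set, which the next two lemmas provide. *)
Lemma adj_connect_sym (T : finType) (G : graph T) : connect_sym (adj G).
Proof. by apply: sym_connect_sym => u v; rewrite /adj /= setUC. Qed.

Lemma adj_closed (T : finType) (G : graph T) : closed (adj G) (vset G).
Proof.
move=> u v; rewrite /adj /= => /(forall_inP (graphP G)) /andP[/subsetP sub _].
by rewrite /vset !sub // !inE eqxx ?orbT.
Qed.

Definition kappa (T : finType) (G : graph T) : nat := n_comp (adj G) (vset G).

Definition kappa_max (T : finType) (G : graph T) (l : nat) : nat :=
  \max_(H : graph T | subgraph H G && (#|eset H| == l)) kappa H.

(* {0,1}^I and Boolean functions on it.  The index set is an arbitrary finite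
   type rather than [m], so that E needs no explicit enumeration. *)
Notation cube I := {ffun I -> bool}.
Notation boolfun I := {ffun cube I -> bool}.

Definition restr (I : finType) (A : {set I}) (x : cube I) :
  cube {i : I | i \in A} := [ffun i => x (val i)].

Definition set_rectangle (I : finType) (A : {set I}) (f : boolfun I) : bool :=
  [exists g : boolfun {i : I | i \in A},
   exists h : boolfun {i : I | i \in ~: A},
   forall x : cube I, f x == g (restr A x) && h (restr (~: A) x)].

Definition rectangle (I : finType) (k : nat) (f : boolfun I) : bool :=
  [exists A : {set I}, (#|A| == k) && set_rectangle A f].

Definition is_or_of_rectangles (I : finType) (f : boolfun I) (k r : nat) : bool :=
  [exists R : {ffun 'I_r -> boolfun I},
    [forall i, rectangle k (R i)] && [forall x, f x == [exists i, R i x]]].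

(* The bound on [k] is what makes a cover exist. *)
Lemma rectangle_cover_exists (I : finType) (f : boolfun I) (k : 'I_#|I|.+1) :
  exists r, is_or_of_rectangles f k r.
Proof.
pose A := [set i in take k (enum I)].
have cardA : #|A| == k.
  rewrite cardsE (card_uniqP _) ?take_uniq ?enum_uniq // size_takel //.
  by rewrite -cardE -ltnS.
pose S := [set x | f x].
exists #|S|; apply/existsP; exists [ffun i => [ffun x => x == enum_val i]].
apply/andP; split; apply/forallP.
  move=> i; rewrite ffunE; apply/existsP; exists A; rewrite cardA /=.
  apply/existsP; exists [ffun y => y == restr A (enum_val i)].
  apply/existsP; exists [ffun y => y == restr (~: A) (enum_val i)].
  apply/forallP => x; rewrite !ffunE; apply/eqP.
  apply/idP/andP => [/eqP -> //|]; case=> /eqP eA /eqP eB; apply/eqP/ffunP => j.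
  have [jA|jA] := boolP (j \in A).
    by have /ffunP/(_ (exist _ j jA)) := eA; rewrite !ffunE.
  have jB : j \in ~: A by rewrite inE.
  by have /ffunP/(_ (exist _ j jB)) := eB; rewrite !ffunE.
move=> x; apply/eqP; apply/idP/existsP => [fx|[i]].
  have xS : x \in S by rewrite inE.
  by exists (enum_rank_in xS x); rewrite !ffunE enum_rankK_in.
by rewrite !ffunE => /eqP ->; have := enum_valP i; rewrite inE.
Qed.

Definition rect_cover (I : finType) (f : boolfun I) (k : 'I_#|I|.+1) : nat :=
  ex_minn (rectangle_cover_exists f k).

Definition max_rect_cover (I : finType) (f : boolfun I) : nat :=
  \max_(k : 'I_#|I|.+1 | 0 < k) rect_cover f k.

Notation edge G := {e : {set _} | e \in eset G}.

(* Booleans are coerced to 0 and 1 in [nat]; only the values of [c] on [vset G]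
   matter. *)
Definition tseitin (T : finType) (G : graph T) (c : T -> bool) : boolfun (edge G) :=
  [ffun x : cube (edge G) =>
    [forall v in vset G, \sum_(e : edge G | v \in val e) x e == c v %[mod 2]]].

Definition satisfiable (I : finType) (f : boolfun I) : Prop := exists x, f x.

(* Main.v *)
(** For an edge set A let Z(A) be the F_2-space of edge vectors supported on A
    that have even degree at every vertex, so that dim Z(A) = |A| - n + kappa(V, A).
    The solutions of a satisfiable Tseitin formula form a translate of Z(E).  In
    an A-rectangle contained in the solution set either half can be frozen while
    the other varies, so the halves lie in translates of Z(A) and of Z(E \ A), and
    the rectangle has at most |Z(A)| |Z(E \ A)| points.  Dividing the number of
    solutions by this bound gives the lower bound on the size of a cover. *)
Require Import Defs.
From mathcomp Require Import all_boot all_order all_algebra.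
Set Implicit Arguments.
Unset Strict Implicit.
Unset Printing Implicit Defensive.
Import Order.TTheory GRing.Theory Num.Theory.
Local Open Scope ring_scope.

(** * Kernels over F_2 counted by sign sums *)

Definition cube_on (I : finType) (A : {set I}) : {set cube I} :=
  [set x : cube I | [forall i, x i ==> (i \in A)]].

(** The left kernel over F_2 of the submatrix of [r] with rows [A] and columns [B]. Vectors are
    extended by zero to all of [I], so kernels for different [A] live in one type. *)
Definition kernel_on (I J : finType) (r : I -> J -> bool)
    (A : {set I}) (B : {set J}) : {set cube I} :=
  [set x : cube I in cube_on A |
    [forall j in B, ~~ \big[addb/false]_i (x i && r i j)]].

(** Orthogonality of characters: the sum factors over coordinates, with factor 1 off [A] and 1 +
    (-1)^(d i) on [A]. *)
Lemma sign_sum_cube_on (I : finType) (A : {set I}) (d : I -> bool) :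
  \sum_(x in cube_on A) \prod_i (-1 : int) ^+ (x i && d i) =
  if [forall i in A, ~~ d i] then 2 ^+ #|A| else 0.
Proof.
transitivity (\prod_i \sum_(b : bool | b ==> (i \in A)) (-1 : int) ^+ (b && d i)).
  rewrite bigA_distr_big_dep; apply: eq_bigl => x.
  rewrite inE; apply/forallP/familyP => h i; exact: h.
transitivity (\prod_(i in A) if d i then 0 else 2 : int).
  rewrite [RHS]big_mkcond; apply: eq_bigr => i _.
  rewrite big_mkcond big_bool /=.
  by case: (i \in A); case: (d i); rewrite ?expr1 ?expr0 ?add0r ?addNr.
case: ifP => [/forall_inP h | /negbT].
  by rewrite (eq_bigr (fun=> 2)) ?prodr_const // => i /h /negbTE ->.
rewrite negb_forall_in => /exists_inP[i iA /negPn di].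
by rewrite (bigD1 i) //= di mul0r.
Qed.

Lemma sign_big_addb (I : finType) (F : I -> bool) :
  (-1 : int) ^+ (\big[addb/false]_i F i) = \prod_i (-1) ^+ F i.
Proof.
by apply: (big_morph (fun b : bool => (-1 : int) ^+ b)) => // a b; rewrite signr_addb.
Qed.

(* Both sides count, in the two possible orders, the double sum of the signs
   [(-1)^(x^T r y)]; this is the equality of row and column rank over F_2. *)
Lemma card_kernel_on (I J : finType) (r : I -> J -> bool)
    (A : {set I}) (B : {set J}) :
  (#|kernel_on r A B| * 2 ^ #|B| =
   #|kernel_on (fun j i => r i j) B A| * 2 ^ #|A|)%N.
Proof.
have half (K L : finType) (s : K -> L -> bool) (C : {set K}) (D : {set L}) :
  (#|kernel_on s C D| * 2 ^ #|D|)%N%:R = \sum_(x in cube_on C)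
    \sum_(y in cube_on D) \prod_k \prod_l (-1 : int) ^+ [&& x k, y l & s k l].
  transitivity (\sum_(x in cube_on C)
      if [forall l in D, ~~ \big[addb/false]_k (x k && s k l)]
      then (2 : int) ^+ #|D| else 0).
    rewrite -big_mkcondr /= natrM natrX mulr_natl -sumr_const.
    by apply: eq_bigl => x; rewrite [LHS]inE.
  apply: eq_bigr => x _; rewrite -sign_sum_cube_on; apply: eq_bigr => y _.
  rewrite exchange_big /=; apply: eq_bigr => l _.
  have -> : y l && \big[addb/false]_k (x k && s k l) =
            \big[addb/false]_k [&& x k, y l & s k l].
    case: (y l) => //=; rewrite big1 // => k _; exact: andbF.
  exact: sign_big_addb.
apply/eqP; rewrite -(eqr_nat int) !half exchange_big /=; apply/eqP.
apply: eq_bigr => y _; apply: eq_bigr => x _; rewrite exchange_big /=.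
by apply: eq_bigr => j _; apply: eq_bigr => i _; rewrite andbCA.
Qed.

(** * Cut and cycle spaces of spanning subgraphs *)

Section SpanningSubgraph.
Variables (T : finType) (G : graph T).
Implicit Types A : {set edge G}.

Lemma spanning_axiom A : graph_axiom (vset G, val @: A).
Proof.
apply/forall_inP => _ /imsetP[e _ ->] /=.
exact: (forall_inP (graphP G) _ (valP e)).
Qed.

(** All vertices are kept, so isolated ones count as components, as the dimension formula for Z(A)
    requires. *)
Definition spanning A : graph T := Graph (spanning_axiom A).

Lemma spanning_subgraph A : subgraph (spanning A) G.
Proof.
rewrite /subgraph subxx; apply/subsetP => _ /imsetP[e _ ->]; exact: valP.
Qed.

Lemma card_eset_spanning A : #|eset (spanning A)| = #|A|.
Proof. exact/card_imset/val_inj. Qed.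

Lemma kappa_spanning_le A : (kappa (spanning A) <= kappa_max G #|A|)%N.
Proof.
apply: (@leq_bigmax_cond _ _ (@kappa T)).
by rewrite spanning_subgraph card_eset_spanning eqxx.
Qed.

Lemma spanning_setT : spanning setT = G.
Proof.
apply: val_inj; rewrite /= [RHS]surjective_pairing; congr (_, _).
apply/setP => e; apply/imsetP/idP => [[e' _ ->]|eE]; first exact: valP.
by exists (exist _ e eE); rewrite ?inE.
Qed.

Definition incident (e : edge G) (v : T) : bool := v \in val e.

(** An edge has exactly two ends u and v, so its sum is y u + y v, which vanishes iff [y] is
    constant along the edge. *)
Lemma kernel_cut A (y : cube T) :
  (y \in kernel_on (fun v e => incident e v) (vset G) A) =
  (y \in cube_on (vset G)) &&
  [forall u, forall v, adj (spanning A) u v ==> (y u == y v)].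
Proof.
rewrite inE; congr (_ && _).
have sum2 (e : edge G) u v : val e = [set u; v] -> u != v ->
    \big[addb/false]_w (y w && incident e w) = y u (+) y v.
  move=> ee uv; transitivity (\big[addb/false]_(w in [set u; v]) y w).
    rewrite [RHS]big_mkcond; apply: eq_bigr => w _.
    by rewrite /incident ee; case: ifP; rewrite ?andbT ?andbF.
  by rewrite big_setU1 ?inE //= big_set1.
have edge2 (e : edge G) : #|val e| = 2.
  by have /andP[_ /eqP] := forall_inP (graphP G) _ (valP e).
apply/forall_inP/forallP => [h u|h e eA].
  apply/forallP => v; apply/implyP => /imsetP[e eA ee].
  have uv : u != v by have := edge2 e; rewrite -ee cards2; case: eqP.
  by have := h e eA; rewrite (sum2 e u v) // addbC negb_add eq_sym.
have /eqP/cards2P[u [v [uv ee]]] := edge2 e.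
rewrite (sum2 e u v) // negb_add.
have /forallP/(_ v)/implyP := h u; apply.
by rewrite /adj /= -ee; apply: imset_f.
Qed.

(** Vectors constant along edges are indicators of unions of components, hence correspond to sets of
    component roots. *)
Lemma card_kernel_cut A :
  #|kernel_on (fun v e => incident e v) (vset G) A| = (2 ^ kappa (spanning A))%N.
Proof.
set H := spanning A; have symH := adj_connect_sym H.
pose R := [set v in vset G | v \in roots (adj H)].
have clV : closed (adj H) (vset G) := @adj_closed T H.
have <- : #|R| = kappa H.
  by rewrite /kappa /n_comp_mem; apply: eq_card => v; rewrite !inE andbC.
(* The indicator of the union of the components whose root lies in [Z]. *)
pose F (Z : {set T}) : cube T :=
  [ffun v => (v \in vset G) && (fingraph.root (adj H) v \in Z)].
rewrite -card_powerset -(@card_in_imset _ _ F); last first.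
  move=> Z1 Z2; rewrite !inE => s1 s2 /ffunP eF; apply/setP => v.
  have [vR|vR] := boolP (v \in R); last first.
    by rewrite !(contraNF (subsetP _ v) vR).
  have := eF v; rewrite !ffunE; move: vR; rewrite inE => /andP[-> /eqP ->] //.
apply: eq_card => y; rewrite kernel_cut -/H; apply/andP/imsetP.
  case; rewrite inE => /forallP yV /forallP yc.
  have cly : closed (adj H) [pred v | y v].
    by move=> u v uv; have /forallP/(_ v)/implyP/(_ uv)/eqP := yc u.
  exists [set v in R | y v].
    by rewrite inE; apply/subsetP => v; rewrite inE => /andP[].
  apply/ffunP => v; rewrite ffunE in_set in_set.
  have cv := connect_root (adj H) v.
  have /= <- : y v = y (fingraph.root (adj H) v) := closed_connect cly cv.
  have <- : (v \in vset G) = (fingraph.root (adj H) v \in vset G) :=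
    closed_connect clV cv.
  rewrite [_ \in roots _](roots_root symH) andbT andbA andbb andbC.
  by have /implyP := yV v; case: (y v) => // ->.
case=> Z _ ->; split.
  by rewrite inE; apply/forallP => v; rewrite ffunE; apply/implyP=> /andP[].
apply/forallP => u; apply/forallP => v; apply/implyP => uv.
rewrite !ffunE (clV _ _ uv).
by have /(fingraph.rootP symH) -> := connect1 uv.
Qed.

Definition cycles A : {set cube (edge G)} := kernel_on incident A (vset G).

(** The dimension formula for Z(A), with the denominator 2^n cleared to stay in [nat]; rank equality
    reduces it to the kernel on the vertex side. *)
Lemma card_cycles A :
  (#|cycles A| * 2 ^ #|vset G| = 2 ^ (#|A| + kappa (spanning A)))%N.
Proof. by rewrite card_kernel_on card_kernel_cut mulnC -expnD. Qed.

End SpanningSubgraph.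

(** * Solutions of the Tseitin formula and rectangles inside them *)

Section TseitinRectangles.
Variables (T : finType) (G : graph T) (c : T -> bool).
Implicit Types (A : {set edge G}) (x y : cube (edge G)).
Local Notation f := (tseitin G c).

Definition cube_add (I : finType) (x y : cube I) : cube I :=
  [ffun i => x i (+) y i].

Definition cube_mask (I : finType) (A : {set I}) (x : cube I) : cube I :=
  [ffun i => (i \in A) && x i].

Lemma tseitinE x :
  f x = [forall v in vset G, \big[addb/false]_e (x e && incident e v) == c v].
Proof.
rewrite ffunE; apply: eq_forallb_in => v _.
rewrite !modn2 oddb (inj_eq (can_inj oddb)); congr (_ == _).
rewrite (big_morph odd oddD (erefl (odd 0))) big_mkcond; apply: eq_bigr => e _.
by rewrite oddb /incident; case: ifP; rewrite ?andbT ?andbF.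
Qed.

Lemma big_addb_cube_add x y v :
  \big[addb/false]_e (cube_add x y e && incident e v) =
  \big[addb/false]_e (x e && incident e v) (+)
  \big[addb/false]_e (y e && incident e v).
Proof. by rewrite -big_split; apply: eq_bigr => e _; rewrite ffunE andb_addl. Qed.

Lemma tseitin_cube_add x y : f x -> y \in cycles setT -> f (cube_add x y).
Proof.
rewrite !tseitinE inE => /forall_inP fx /andP[_ /forall_inP cy].
apply/forall_inP => v vV; rewrite big_addb_cube_add (eqP (fx v vV)).
by rewrite (negbTE (cy v vV)) addbF.
Qed.

Lemma cycles_cube_add A x y : f x -> f y -> cube_add x y \in cube_on A ->
  cube_add x y \in cycles A.
Proof.
rewrite !tseitinE => /forall_inP fx /forall_inP fy on_A; rewrite inE on_A /=.
apply/forall_inP => v vV; rewrite big_addb_cube_add.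
by rewrite (eqP (fx v vV)) (eqP (fy v vV)) addbb.
Qed.

(** Translation by one solution embeds Z(E) in the solution set. *)
Lemma card_tseitin_ge : satisfiable f ->
  (#|cycles [set: edge G]| <= #|[set x | f x]|)%N.
Proof.
case=> x fx; rewrite -(@card_imset _ _ (cube_add x) (cycles [set: edge G])); last first.
  by move=> y z /ffunP e; apply/ffunP => i; have := e i; rewrite !ffunE => /addbI.
apply/subset_leq_card/subsetP => _ /imsetP[y cy ->].
by rewrite inE tseitin_cube_add.
Qed.

Lemma eq_in_restr (I : finType) (A : {set I}) (x y : cube I) :
  {in A, x =1 y} -> restr A x = restr A y.
Proof. by move=> e; apply/ffunP => -[i iA]; rewrite !ffunE e. Qed.

(* Gluing [x] on [A] with a fixed [y] off [A] stays inside the rectangle, so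
   [x + y] restricted to [A], and likewise to its complement, is a cycle. *)
Lemma card_rectangle_le A (R : boolfun (edge G)) :
  set_rectangle A R -> (forall x, R x -> f x) ->
  (#|[set x | R x]| <= #|cycles A| * #|cycles (~: A)|)%N.
Proof.
case/existsP=> g /existsP[h /forallP hR] Rf.
have [->|[y]] := set_0Vmem [set x | R x]; first by rewrite cards0.
rewrite inE => Ry; rewrite -cardsX.
(* The two halves together recover [x + y], hence [x], since [y] is fixed. *)
pose F x := (cube_mask A (cube_add x y), cube_mask (~: A) (cube_add x y)).
rewrite -(@card_imset _ _ F [set x | R x]); last first.
  move=> x z [/ffunP e1 /ffunP e2]; apply/ffunP => i.
  have := e1 i; have := e2 i; rewrite !ffunE inE.
  by case: (i \in A) => /= [_|+ _]; exact: addIb.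
have glue B x : R x -> (B = A) \/ (B = ~: A) ->
    cube_mask B (cube_add x y) \in cycles B.
  move=> Rx hB; pose z : cube (edge G) := [ffun i => if i \in B then x i else y i].
  have -> : cube_mask B (cube_add x y) = cube_add z y.
    by apply/ffunP => i; rewrite !ffunE; case: ifP; rewrite ?addbb.
  apply: cycles_cube_add; [|exact: Rf|]; last first.
    rewrite inE; apply/forallP => i; rewrite !ffunE.
    by case: ifP; rewrite ?implybT ?addbb.
  apply: Rf; rewrite (eqP (hR z)).
  have zB : {in B, z =1 x} by move=> i iB; rewrite ffunE iB.
  have zC : {in ~: B, z =1 y} by move=> i; rewrite inE ffunE => /negbTE ->.
  move: Rx Ry; rewrite (eqP (hR x)) (eqP (hR y)) => /andP[gx hx] /andP[gy hy].
  case: hB => eB; rewrite eB in zB zC.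
    by rewrite (eq_in_restr zB) (eq_in_restr zC) gx hy.
  by rewrite setCK in zC; rewrite (eq_in_restr zB) (eq_in_restr zC) gy hx.
apply/subset_leq_card/subsetP => z /imsetP[x]; rewrite inE => Rx ->.
by rewrite in_setX; apply/andP; split; apply: glue => //; [left|right].
Qed.

Lemma rectangles_lower_bound (k r : nat) : satisfiable f ->
  is_or_of_rectangles f k r ->
  (2 ^ (#|vset G| + kappa G) <=
   r * 2 ^ (kappa_max G k + kappa_max G (#|eset G| - k)))%N.
Proof.
move=> sat /existsP[R /andP[/forallP rectR /forallP fR]].
set n := #|vset G|; set m := #|eset G|; set K := (_ + kappa_max _ _)%N.
have cardE : #|{: edge G}| = m by rewrite card_sig.
(* One factor 2^n clears the denominator for Z(A), the other that for Z(E \ A); the sizes of [A] and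
   its complement add up to [m]. *)
have card1 i : (#|[set x | R i x]| * 2 ^ (n + n) <= 2 ^ (m + K))%N.
  have /existsP[A /andP[/eqP cA rA]] := rectR i.
  have cAC : #|~: A| = (m - k)%N by rewrite cardsCs setCK cardE cA.
  have kA : (k <= m)%N by rewrite -cardE -cA max_card.
  have Rf x : R i x -> f x by move=> Rx; rewrite (eqP (fR x)); apply/existsP; exists i.
  apply: leq_trans (leq_mul (card_rectangle_le rA Rf) (leqnn _)) _.
  rewrite expnD mulnACA !card_cycles -expnD leq_exp2l // cA cAC addnACA subnKC //.
  by rewrite leq_add2l leq_add // -?cAC -?cA kappa_spanning_le.
have cover : (#|[set x | f x]| <= \sum_i #|[set x | R i x]|)%N.
  have -> : [set x | f x] = \bigcup_i [set x | R i x].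
    apply/setP => x; rewrite inE (eqP (fR x)).
    apply/existsP/bigcupP => [[i Rx]|[i _]]; last by rewrite inE; exists i.
    by exists i; rewrite // inE.
  elim/big_rec2: _ => [|i s S _ le]; first by rewrite cards0.
  by apply: leq_trans (leq_card_setU _ _) _; rewrite leq_add2l.
have ones := card_tseitin_ge sat.
have := card_cycles [set: edge G]; rewrite spanning_setT cardsT cardE -/n => cyc.
(* Multiplied by 2^m, the left side becomes |Z(E)| 2^(n + n), which [cover] and the sum of [card1]
   over the rectangles bound. *)
rewrite -(@leq_pmul2l (2 ^ m)) ?expn_gt0 // mulnCA -!expnD.
rewrite (_ : m + (n + kappa G) = m + kappa G + n)%N; last by rewrite addnAC addnA.
rewrite expnD -cyc -mulnA -expnD.
apply: leq_trans (leq_mul (leq_trans ones cover) (leqnn _)) _.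
rewrite big_distrl /=; apply: leq_trans (leq_sum _ (fun i _ => card1 i)) _.
by rewrite sum_nat_const card_ord.
Qed.

End TseitinRectangles.

(** * The bound with integer exponents, over the rationals *)

Theorem theorem5p1 (T : finType) (G : graph T) (c : T -> bool) (n m : nat)
    (hn : #|vset G| = n) (hm : #|eset G| = m)
    (hsat : satisfiable (tseitin G c)) :
  \big[Num.max/0]_(1 <= l < m.+1)
     ((2 : rat) ^ (n%:Z - (kappa_max G l)%:Z - (kappa_max G (m - l)%N)%:Z
                    + (kappa G)%:Z))
  <= (max_rect_cover (tseitin G c))%:R :> rat.
Proof.
(* The maximum is bounded term by term; its default 0, the value when [m = 0], lies below any
   natural number. *)
rewrite big_seq; elim/big_ind: _ => [|a b ha hb|l]; first exact: ler0n.
  by rewrite ge_max ha hb.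
rewrite mem_index_iota => /andP[l_gt0 lm].
have lE : (l < #|{: edge G}|.+1)%N by rewrite card_sig hm.
apply: (@le_trans _ _ (rect_cover (tseitin G c) (Ordinal lE))%:R); last first.
  by rewrite ler_nat /max_rect_cover (leq_bigmax_cond (Ordinal lE)).
have : is_or_of_rectangles (tseitin G c) (Ordinal lE)
         (rect_cover (tseitin G c) (Ordinal lE)).
  by rewrite /rect_cover; case: ex_minnP.
move=> /(rectangles_lower_bound hsat); rewrite hn hm /=.
move: (rect_cover _ _) (kappa_max G l) (kappa_max G (m - l)) => r a b.
rewrite -(ler_nat rat) natrM !natrX => le.
(* The exponent may be negative, so it is split into a quotient of two natural powers of 2. *)
have -> : n%:Z - a%:Z - b%:Z + (kappa G)%:Z = (n + kappa G)%N%:Z - (a + b)%N%:Z.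
  by rewrite !PoszD opprD addrAC (addrAC n%:Z) !addrA.
by rewrite expfzDr // -invr_expz ler_pdivrMr ?exprn_gt0.
Qed.
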